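(* Let $(X,T)$ be a Polish dynamical system. If $\varphi\colon X\to\mathbb{R}$ is bounded and continuous and $\alpha\in\mathbb{R}$, then the set $B_\varphi(\alpha)=\{x\in X:\lim_{k\to\infty}A_k\varphi(x)=\alpha\}$ of $\alpha$-Birkhoff regular points is a $\boldsymbol{\Pi}^0_3$ set.
   Context: A Polish dynamical system $(X,T)$ is a Polish space $X$ with a continuous map $T\colon X\to X$. $A_k\varphi(x)=\frac1k\sum_{j=0}^{k-1}\varphi(T^j(x))$ for $k\ge1$. $\boldsymbol{\Sigma}^0_1$ = open sets, $\boldsymbol{\Pi}^0_n$ = complements of $\boldsymbol{\Sigma}^0_n$ sets, $\boldsymbol{\Sigma}^0_{n+1}$ = countable unions of $\boldsymbol{\Pi}^0_n$ sets; so $\boldsymbol{\Pi}^0_3$ sets are the countable intersections of $F_\sigma$ sets. *)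

(* Defs.v *)
From mathcomp Require Import all_boot all_order all_algebra.
From mathcomp Require Import all_classical all_reals all_analysis.

Set Implicit Arguments.
Unset Strict Implicit.
Unset Printing Implicit Defensive.

Import Order.TTheory GRing.Theory Num.Theory.
Import numFieldNormedType.Exports.

Local Open Scope classical_set_scope.
Local Open Scope ring_scope.

Section Polish.
Variables (R : realType) (X : topologicalType).

Record is_distance (d : X -> X -> R) : Prop := IsDistance {
  dist_ge0 : forall x y, 0 <= d x y ;
  dist_eq0 : forall x y, d x y = 0 <-> x = y ;
  dist_sym : forall x y, d x y = d y x ;
  dist_triangle : forall x y z, d x z <= d x y + d y z }.

Definition induces_topology (d : X -> X -> R) : Prop :=
  forall (x : X) (A : set X),
    nbhs x A <-> exists2 e : R, 0 < e & [set y | d x y < e] `<=` A.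

Definition cauchy_seq (d : X -> X -> R) (u : nat -> X) : Prop :=
  forall e : R, 0 < e ->
    exists N : nat, forall m n : nat, (N <= m)%N -> (N <= n)%N ->
      d (u m) (u n) < e.

Definition complete_distance (d : X -> X -> R) : Prop :=
  forall u : nat -> X, cauchy_seq d u -> exists l : X, u @ \oo --> l.

Definition completely_metrizable : Prop :=
  exists d : X -> X -> R,
    [/\ is_distance d, induces_topology d & complete_distance d].

Definition separable : Prop := exists2 D : set X, countable D & dense D.

Definition polish : Prop := separable /\ completely_metrizable.

Definition polish_system (T : X -> X) : Prop := polish /\ continuous T.

End Polish.

Section BorelHierarchy.
Variable X : topologicalType.

(* The levels start at 1; level 0 is a dummy, empty, class. *)
Fixpoint Sigma0 (n : nat) : set (set X) :=
  match n with
  | 0 => set0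
  | 1 => open
  | n'.+1 => [set A | exists2 F : nat -> set X,
      (forall i, (setC @` Sigma0 n') (F i)) & A = \bigcup_i F i]
  end.

Definition Pi0 (n : nat) : set (set X) := setC @` Sigma0 n.

End BorelHierarchy.

Section Birkhoff.
Variables (R : realType) (X : Type).

(* At k = 0 this is the junk value 0, irrelevant to the limit in k. *)
Definition birkhoff_avg (T : X -> X) (phi : X -> R) (k : nat) (x : X) : R :=
  k%:R^-1 * \sum_(0 <= j < k) phi (iter j T x).

Definition birkhoff_regular (T : X -> X) (phi : X -> R) (alpha : R) : set X :=
  [set x | birkhoff_avg T phi k x @[k --> \oo] --> alpha].

End Birkhoff.

(* Main.v *)
Require Import Defs.
From mathcomp Require Import all_boot all_order all_algebra.
From mathcomp Require Import all_classical all_reals all_analysis.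
Import numFieldNormedType.Exports.
Import Order.TTheory GRing.Theory Num.Theory.
Local Open Scope classical_set_scope.
Local Open Scope ring_scope.

(** Each average $A_k\varphi$ is continuous, as a scaled finite sum of the maps $\varphi\circ T^j$
    ([continuous_birkhoff_avg]). Convergence to $\alpha$ reads: for all $m$ there is $N$ such that
    $|\alpha-A_k\varphi(x)|\le 1/(m+1)$ for all $k\ge N$ ([cvg_setE]). The innermost condition is
    closed, and so is its intersection over $k\ge N$; the union over $N$ is $F_\sigma$, and the
    intersection over $m$ is $\Pi^0_3$ ([Pi0_3_cvg_set]). *)

Lemma Sigma0_2_bigcup_closed (X : topologicalType) (F : nat -> set X) :
  (forall i, closed (F i)) -> Sigma0 2 (\bigcup_i F i).
Proof.
move=> cF; exists F => // i; exists (~` F i); last by rewrite setCK.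
by apply: closed_openC; exact: cF.
Qed.

Lemma Pi0_bigcap (X : topologicalType) (n : nat) (F : nat -> set X) :
  (forall i, Sigma0 n.+1 (F i)) -> Pi0 n.+2 (\bigcap_i F i).
Proof.
move=> SF; exists (\bigcup_i ~` F i).
  by exists (fun i => ~` F i) => // i; exists (F i).
by rewrite setC_bigcup; apply: eq_bigcapr => i _; rewrite setCK.
Qed.

(** The tolerances $1/(m+1)$ keep the outer intersection countable; the non-strict inequality makes
    the inner sets closed once the [f k] are continuous. *)
Lemma cvg_setE (R : realType) (X : Type) (f : nat -> X -> R) (a : R) :
  [set x | f k x @[k --> \oo] --> a] =
  \bigcap_m \bigcup_N \bigcap_(k in [set k | (N <= k)%N])
    [set x | `|a - f k x| <= m.+1%:R^-1].
Proof.
apply/seteqP; split => x /=.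
  move=> /cvgrPdist_le cf m _.
  have [|N _ HN] := cf m.+1%:R^-1; first by rewrite invr_gt0.
  by exists N => // k Nk; exact: HN.
move=> fx; apply/cvgrPdist_le => e e0.
have [m me] : exists m : nat, m.+1%:R^-1 <= e.
  (* Archimedean choice: $m=\lfloor 1/e\rfloor$ gives $1/e<m+1$. *)
  exists (Num.truncn e^-1); rewrite invf_ple ?posrE // ltW //.
  by apply: truncnS_gt.
have [N _ HN] := fx m I.
by exists N => // k /HN /le_trans; exact.
Qed.

Lemma Pi0_3_cvg_set (R : realType) (X : topologicalType) (f : nat -> X -> R)
    (a : R) :
  (forall k, continuous (f k)) -> Pi0 3 [set x | f k x @[k --> \oo] --> a].
Proof.
move=> cf; rewrite cvg_setE; apply: Pi0_bigcap => m.
apply: Sigma0_2_bigcup_closed => N; apply: closed_bigI => k _.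
have cd : continuous (fun x => `|a - f k x|).
  move=> x; apply: cvg_norm; apply: cvgB; first exact: cvg_cst.
  exact: cf.
(* Preimage of a closed half-line under a continuous map. *)
by apply: (preimage_closed (f := fun x => `|a - f k x|)) (@closed_le _ _) => x _.
Qed.

Lemma continuous_iter (X : topologicalType) (T : X -> X) (n : nat) :
  continuous T -> continuous (iter n T).
Proof.
move=> cT; elim: n => [|n IHn] x /=; first exact: cvg_id.
by apply: (continuous_comp (f := iter n T)); [exact: IHn | exact: cT].
Qed.

Lemma continuous_birkhoff_avg (R : realType) (X : topologicalType)
    (T : X -> X) (phi : X -> R) (k : nat) :
  continuous T -> continuous phi -> continuous (birkhoff_avg T phi k).
Proof.
(* The factor [k%:R^-1] is constant in [x], so [k = 0] is no special case. *)
move=> cT cphi x; rewrite /birkhoff_avg; apply: cvgM; first exact: cvg_cst.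
apply: cvg_big => [|j _]; first exact: add_continuous.
apply: (continuous_comp (f := iter j T)).
  exact: continuous_iter.
exact: cphi.
Qed.

Theorem fact12 (R : realType) (X : topologicalType) (T : X -> X)
    (hXT : polish_system R T) (phi : X -> R) (hb : bounded_fun phi)
    (hc : continuous phi) (alpha : R) :
  Pi0 3 (birkhoff_regular T phi alpha).
Proof.
have [_ cT] := hXT.
by apply: Pi0_3_cvg_set => k; exact: continuous_birkhoff_avg.
Qed.
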